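(* Let $p$ be a prime and let $G=D_{2p}$. Then $$E(\mathcal{B}(G))=2+2p\sqrt{3}+2\sqrt{p^2-1}+2\sqrt{3p(p-1)},$$ $$LE(\mathcal{B}(G))=LE^+(\mathcal{B}(G))=\frac{32p^4+2p^2+12p+18}{4p^2+p+3},$$ and $$E_{CN}(\mathcal{B}(G))=8p^2-2p-6.$$
   Context: $D_{2m}=\langle a,b : a^m=b^2=1,\ bab=a^{-1}\rangle$ is the dihedral group of order $2m$ (for $m=2$ it is the group of order $4$ given by this presentation). For a finite group $G$, let $L(G)$ be the set of all subgroups of $G$. The subgroup generating bipartite graph $\mathcal{B}(G)$ is the simple bipartite graph with vertex set the disjoint union of $G\times G$ and $L(G)$, in which $(a,b)\in G\times G$ and $H\in L(G)$ are adjacent if and only if $H$ is the subgroup generated by $a$ and $b$ (and there are no other edges). For a finite simple graph $\Gamma$ with $n$ vertices $v_1,\dots,v_n$ and $m$ edges, let $A$ be its adjacency matrix, $D$ its diagonal degree matrix, and $CN(\Gamma)$ the common neighborhood matrix, whose $(i,j)$ entry for $i\neq j$ is the number of vertices other than $v_i,v_j$ adjacent to both $v_i$ and $v_j$, with zero diagonal. The energy $E(\Gamma)$ and the common neighborhood energy $E_{CN}(\Gamma)$ are the sums of absolute values of the eigenvalues (with multiplicity) of $A$ and $CN(\Gamma)$ respectively. The Laplacian energy is $LE(\Gamma)=\sum_{\lambda}|\lambda-\frac{2m}{n}|$ over the eigenvalues $\lambda$ of $D-A$, and the signless Laplacian energy is $LE^+(\Gamma)=\sum_{\mu}|\mu-\frac{2m}{n}|$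 over the eigenvalues $\mu$ of $D+A$ (both counted with multiplicity). *)

(* Defs.v *)
From HB Require Import structures.
From mathcomp Require Import all_boot all_order all_algebra all_fingroup.

Set Implicit Arguments.
Unset Strict Implicit.
Unset Printing Implicit Defensive.

Import GRing.Theory Num.Theory.

Local Open Scope ring_scope.

Record sgraph := SGraph {
  vertex :> finType;
  adj : rel vertex;
  adj_sym : symmetric adj;
  adj_irrefl : irreflexive adj
}.

Section Graph.
Variable X : sgraph.

Definition edges : {set {set X}} :=
  [set [set e.1; e.2] | e in [pred e : X * X | adj e.1 e.2]].

Definition degree (x : X) : nat := #|[set y | adj x y]|.

Definition common_nbrs (x y : X) : {set X} :=
  [set z | [&& z != x, z != y, adj x z & adj y z]].

End Graph.

(* Matrices are indexed by 'I_#|X|, with enum_val i as the i-th vertex.       *)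
(* The scalars form an algebraically closed field with a norm, e.g. the       *)
(* complex numbers, so that every characteristic polynomial splits and        *)
(* `|x| is the modulus.                                                       *)
Section Energies.
Variable C : numClosedFieldType.

(* The roots of the characteristic polynomial, repeated according to their    *)
(* multiplicity; the list is unique up to permutation.                        *)
Definition eigenvalues n (A : 'M[C]_n) : seq C :=
  sval (closed_field_poly_normal (char_poly A)).

Lemma eigenvaluesP n (A : 'M[C]_n) :
  char_poly A = \prod_(x <- eigenvalues A) ('X - x%:P).
Proof.
rewrite /eigenvalues; case: closed_field_poly_normal => /= s.
by rewrite (monicP (char_poly_monic A)) scale1r.
Qed.

Variable X : sgraph.

Definition adj_mx : 'M[C]_#|X| :=
  \matrix_(i, j) (adj (enum_val i) (enum_val j))%:R.

Definition deg_mx : 'M[C]_#|X| :=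
  diag_mx (\row_i (degree (enum_val i))%:R).

Definition cn_mx : 'M[C]_#|X| :=
  \matrix_(i, j)
    if i == j then 0 else #|common_nbrs (enum_val i) (enum_val j)|%:R.

Definition avg_degree : C := 2 * #|edges X|%:R / #|X|%:R.

Definition energy : C := \sum_(x <- eigenvalues adj_mx) `|x|.

Definition cn_energy : C := \sum_(x <- eigenvalues cn_mx) `|x|.

Definition laplacian_energy : C :=
  \sum_(x <- eigenvalues (deg_mx - adj_mx)) `|x - avg_degree|.

Definition signless_laplacian_energy : C :=
  \sum_(x <- eigenvalues (deg_mx + adj_mx)) `|x - avg_degree|.

End Energies.

(* The subgroup generating bipartite graph of the finite group gT; L(G) is    *)
(* the type {group gT} of all its subgroups.                                  *)
Section GeneratingGraph.
Variable gT : finGroupType.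

Definition gen_vertex : finType := ((gT * gT) + {group gT})%type.

Definition gen_adj : rel gen_vertex := fun u v =>
  match u, v with
  | inl ab, inr H | inr H, inl ab => (H : {set gT}) == <<[set ab.1; ab.2]>>%g
  | _, _ => false
  end.

Lemma gen_adj_sym : symmetric gen_adj.
Proof. by move=> [ab|H] [ab'|H']. Qed.

Lemma gen_adj_irrefl : irreflexive gen_adj.
Proof. by case. Qed.

Definition gen_graph : sgraph := SGraph gen_adj_sym gen_adj_irrefl.

End GeneratingGraph.

Definition is_dihedral (gT : finGroupType) (m : nat) : Prop :=
  ([set: gT] \isog Grp (a : b : (a ^+ m, b ^+ 2, b * a * b = a^-1)))%g.

(* Main.v *)
Require Import Defs.
From HB Require Import structures.
From mathcomp Require Import all_boot all_order all_algebra all_fingroup.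
From mathcomp Require Import all_solvable ring zify.

Set Implicit Arguments.
Unset Strict Implicit.
Unset Printing Implicit Defensive.

Import Order.TTheory GRing.Theory Num.Theory.

Local Open Scope ring_scope.

(** Every pair [(a, b)] generates exactly one subgroup, so each vertex of
    [G * G] has degree one and the subgroup generating graph is a disjoint
    union of stars: the centre [H] carries as many leaves as there are pairs
    generating [H], and no centre is bare as soon as every subgroup needs at
    most two generators.

    For such a star forest, with [m] leaves, [n] centres and [d t] leaves at
    the centre [t], the incidence matrix [B] between leaves and centres
    satisfies [B^T *m B = diag d].  Order the vertices with the leaves first.
    With [A] the adjacency matrix and [D] the degree matrix, the matrices [A],
    [D - A] and [D + A] then have a scalar block on the leaves, and a Schur
    complement reduces their characteristic polynomials to the determinant of a
    diagonal matrix indexed by centres ([char_poly_star_mx]).  The common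
    neighborhood matrix is [B *m B^T - 1] on leaves and [0] elsewhere, and the
    exchange of [B *m B^T] with [B^T *m B] ([det_sylvester]) again leads to a
    diagonal matrix.  The spectra are, apart from a single eigenvalue repeated
    [m - n] times, a union over the centres [t] of
    - [{sqrt (d t), - sqrt (d t)}] for [A];
    - [{0, d t + 1}] for [D - A] and for [D + A];
    - [{0, d t - 1}] for the common neighborhood matrix,
    the repeated eigenvalue being [0], [1] and [-1] respectively.  The two
    Laplacian energies do not even depend on how the leaves are distributed,
    because the average degree [2 m / (m + n)] lies between [1] and [2], so that
    the sign of every [x - 2 m / (m + n)] is known.

    In the dihedral group of order [2 p] with [p] prime, the rotations form a
    subgroup [R] of order [p], and every element outside [R] is an involution.
    The subgroups are therefore [1], [R], the whole group and the [p] subgroups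
    [<[x]>] with [x] outside [R].  Only [(1, 1)] generates the trivial group,
    and a subgroup of prime order [q] is generated by all its [q ^ 2] pairs but
    that one; this gives [p ^ 2 - 1] pairs for [R] and [3] for each [<[x]>], and
    what remains of the [4 p ^ 2] pairs, that is [3 p (p - 1)], generates the
    whole group.  The count also holds for [p = 2], where [R] is one of the three subgroups of
    order [2] and the other two are the [<[x]>]. *)

(** * Determinants and sums over eigenvalues *)

(** The signs of the row and of the column permutation cancel.  The sizes [m]
    and [n] are allowed to differ syntactically so that a matrix indexed by the
    vertices of a graph can be renumbered along a sum of two sizes, without
    casts. *)
Lemma det_mxsub_bij (R : comNzRingType) m n (g : 'I_m -> 'I_n) (A : 'M[R]_n) :
  bijective g -> \det (mxsub g g A) = \det A.
Proof.
move=> g_bij; have := bij_eq_card g_bij; rewrite !card_ord => eq_mn.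
case: n / eq_mn g g_bij A => g /bij_inj g_inj A.
have -> : mxsub g g A = row_perm (perm g_inj) (col_perm (perm g_inj) A).
  by apply/matrixP=> i j; rewrite !mxE !permE.
rewrite row_permE col_permE !det_mulmx !det_perm odd_permV.
by rewrite mulrCA -signr_addb addbb mulr1.
Qed.

Lemma char_poly_mxsub_bij (R : comNzRingType) m n (g : 'I_m -> 'I_n)
    (A : 'M[R]_n) :
  bijective g -> char_poly (mxsub g g A) = char_poly A.
Proof.
move=> g_bij; rewrite /char_poly -(det_mxsub_bij _ g_bij); congr (\det _).
by apply/matrixP=> i j; rewrite !mxE (bij_eq g_bij).
Qed.

Lemma char_poly_mxE (R : nzRingType) n (A : 'M[R]_n) i j :
  char_poly_mx A i j = 'X *+ (i == j) - (A i j)%:P.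
Proof. by rewrite !mxE. Qed.

(** Schur complement of a scalar block.  The factors [a ^+ n] and [a ^+ m] clear
    the denominator [a^-1] of the usual formula, so that [a] can be a linear
    polynomial. *)
Lemma det_scalar_block (R : comNzRingType) m n (a : R) (B : 'M_(m, n))
    (C : 'M_(n, m)) (E : 'M_n) :
  a ^+ n * \det (block_mx a%:M B C E) = a ^+ m * \det (a *: E - C *m B).
Proof.
(* Right multiplication by a matrix of determinant a ^+ n clears B. *)
have := mulmx_block a%:M B C E 1%:M (- B) 0 a%:M.
rewrite !mulmx1 !mulmx0 !addr0 !mulmxN !mul_scalar_mx !mul_mx_scalar addNr.
move/(congr1 determinant); rewrite det_mulmx det_ublock det1 mul1r det_scalar.
by rewrite det_lblock det_scalar (addrC (- _)) mulrC.
Qed.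

Lemma det_block_unit (R : comNzRingType) m n (A : 'M[R]_m) (B : 'M_(m, n))
    (C : 'M_(n, m)) :
  \det (block_mx A B C 1%:M) = \det (A - B *m C).
Proof.
(* Right multiplication by a matrix of determinant 1 clears C. *)
have := mulmx_block A B C 1%:M 1%:M 0 (- C) 1%:M.
rewrite !mulmx1 !mulmx0 !add0r mul1mx mulmxN addrN.
move/(congr1 determinant); rewrite det_mulmx det_lblock !det1 !mulr1 => ->.
by rewrite det_ublock det1 mulr1.
Qed.

(** Both sides are determinants of the block matrix with diagonal blocks [a%:M]
    and [1%:M], computed by eliminating one block or the other. *)
Lemma det_sylvester (R : comNzRingType) m n (a : R) (B : 'M_(m, n))
    (C : 'M_(n, m)) :
  a ^+ n * \det (a%:M - B *m C) = a ^+ m * \det (a%:M - C *m B).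
Proof. by rewrite -det_block_unit det_scalar_block scalemx1. Qed.

(** The list of eigenvalues is determined up to permutation by the factorization
    of the characteristic polynomial.  One repeated root and two roots per index
    [j] is the shape met in star forests. *)
Lemma sum_eigenvalues (C : numClosedFieldType) n (A : 'M[C]_n) (F : C -> C)
    (a : C) (k : nat) (J : finType) (u v : J -> C) :
  char_poly A =
    ('X - a%:P) ^+ k * \prod_j (('X - (u j)%:P) * ('X - (v j)%:P)) ->
  \sum_(x <- eigenvalues A) F x = F a *+ k + \sum_j (F (u j) + F (v j)).
Proof.
pose s := nseq k a ++ [seq u j | j : J] ++ [seq v j | j : J].
move=> charA; have perm_s : perm_eq (eigenvalues A) s.
  apply: prod_XsubC_eq; rewrite -eigenvaluesP charA !big_cat /=.
  by rewrite big_nseq iter_mulr_1 !big_image big_split.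
rewrite (perm_big _ perm_s) !big_cat /= big_nseq iter_addr_0 !big_image.
by rewrite big_split.
Qed.

(** * Star forests *)

(** A star forest is given by the map [f] sending each leaf in [S] to the centre
    in [T] it hangs from. *)
Section StarForest.
Variables (S T : finType) (f : S -> T) (e : rel (S + T)%type).
Hypotheses (e_sym : symmetric e) (e_irrefl : irreflexive e).
Hypothesis e_leaf : forall s s', e (inl s) (inl s') = false.
Hypothesis e_hub : forall t t', e (inr t) (inr t') = false.
Hypothesis e_cross : forall s t, e (inl s) (inr t) = (f s == t).
Hypothesis f_surj : forall t, exists s, f s = t.

Let X := SGraph e_sym e_irrefl.
Let m := #|S|.
Let n := #|T|.

Definition fiber_card (t : T) : nat := #|[set s | f s == t]|.

Lemma fiber_card_gt0 t : (0 < fiber_card t)%N.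
Proof. by have [s <-] := f_surj t; apply/card_gt0P; exists s; rewrite inE. Qed.

Lemma sum_fiber_card : (\sum_t fiber_card t = m)%N.
Proof.
rewrite /m -sum1_card (partition_big f xpredT) //=.
by apply: eq_bigr => t _; rewrite sum1dep_card.
Qed.

Lemma leq_hubs_leaves : (n <= m)%N.
Proof.
rewrite -sum_fiber_card /n -sum1_card.
by apply: leq_sum => t _; apply: fiber_card_gt0.
Qed.

Lemma degree_leaf s : degree (inl s : X) = 1%N.
Proof.
rewrite /degree -(cards1 (inr (f s) : X)); congr #|pred_of_set _|.
apply/setP=> -[s'|t]; rewrite !inE /= ?e_leaf //.
by rewrite e_cross eq_sym.
Qed.

Lemma degree_hub t : degree (inr t : X) = fiber_card t.
Proof.
rewrite /degree /fiber_card.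
rewrite -(card_imset _ (@inl_inj S T)); congr #|pred_of_set _|.
apply/setP=> -[s|t']; rewrite !inE /=.
  rewrite e_sym e_cross.
  apply/idP/imsetP=> [ft|[s' + [->]]]; last by rewrite inE.
  by exists s; rewrite ?inE.
by rewrite e_hub; apply/esym/imsetP=> -[].
Qed.

Lemma card_edges : #|edges X| = m.
Proof.
pose star_edge s : {set X} := [set inl s; inr (f s)].
have star_inj : injective star_edge.
  by move=> s s' /setP/(_ (inl s)); rewrite !inE eqxx /= orbF => /esym/eqP[].
rewrite /m -cardsT -(card_imset _ star_inj); congr #|pred_of_set _|.
apply/setP=> E.
apply/imsetP/imsetP=> [[[x y]]|[s _ ->]]; last first.
  by exists (inl s, inr (f s)); rewrite ?inE //= e_cross.
rewrite inE /=; case: x y => [s|t] [s'|t'] /=; rewrite ?e_leaf ?e_hub //.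
  by rewrite e_cross => /eqP<- ->; exists s.
by rewrite e_sym e_cross => /eqP<- ->; exists s'; rewrite // setUC.
Qed.

Lemma card_vertices : #|X| = (m + n)%N.
Proof. exact: card_sum. Qed.

Lemma common_nbrsC (x y : X) : common_nbrs x y = common_nbrs y x.
Proof.
by apply/setP=> z; rewrite !inE andbCA (andbC (adj x z)).
Qed.

Lemma common_nbrs_leaves s s' :
  s != s' -> #|common_nbrs (inl s : X) (inl s')| = (f s == f s').
Proof.
move=> neq; case: eqVneq => [ff|nff].
  rewrite -[RHS](cards1 (inr (f s) : X)); congr #|pred_of_set _|.
  apply/setP=> -[s1|t]; rewrite !inE /= ?e_leaf ?andbF // !e_cross -ff andbb.
  by rewrite eq_sym.
apply/eqP; rewrite cards_eq0 -subset0; apply/subsetP=> -[s1|t]; rewrite !inE /=.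
  by rewrite e_leaf !andbF.
by rewrite !e_cross => /andP[/eqP ft /eqP ft']; rewrite ft ft' eqxx in nff.
Qed.

Lemma common_nbrs_hubs t t' :
  t != t' -> #|common_nbrs (inr t : X) (inr t')| = 0%N.
Proof.
move=> neq; apply/eqP; rewrite cards_eq0 -subset0; apply/subsetP=> -[s|t1].
  rewrite !inE /= ![e (inr _) _]e_sym !e_cross => /andP[/eqP-> /eqP tt].
  by rewrite tt eqxx in neq.
by rewrite !inE /= !e_hub !andbF.
Qed.

Lemma common_nbrs_mixed s t : #|common_nbrs (inl s : X) (inr t)| = 0%N.
Proof.
apply/eqP; rewrite cards_eq0 -subset0; apply/subsetP=> -[s1|t1];
  rewrite !inE /=.
  by rewrite e_leaf !andbF.
by rewrite e_hub !andbF.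
Qed.

Variable C : numClosedFieldType.

(** Numbers the vertices with the leaves first, whatever the order in which the
    sum type [S + T] is enumerated. *)
Definition vertex_index (i : 'I_(#|S| + #|T|)) : 'I_#|X| :=
  enum_rank (match split i with
             | inl j => inl (enum_val j)
             | inr k => inr (enum_val k)
             end : X).

Lemma vertex_index_bij : bijective vertex_index.
Proof.
apply: inj_card_bij; last by rewrite !card_ord card_sum.
move=> i j /enum_rank_inj; rewrite -[i]splitK -[j]splitK !unsplitK.
case: (split i) (split j) => [a|a] [b|b] //= [/enum_val_inj->] //.
Qed.

Lemma vertex_index_leaf i :
  vertex_index (lshift #|T| i) = enum_rank (inl (enum_val i) : X).
Proof. by rewrite /vertex_index (unsplitK (inl i)). Qed.

Lemma vertex_index_hub i :
  vertex_index (rshift #|S| i) = enum_rank (inr (enum_val i) : X).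
Proof. by rewrite /vertex_index (unsplitK (inr i)). Qed.

Definition vertex_indexE := (vertex_index_leaf, vertex_index_hub).

Definition incidence (R : nzRingType) : 'M[R]_(#|S|, #|T|) :=
  \matrix_(i, j) (f (enum_val i) == enum_val j)%:R.

(** Columns of the incidence matrix are indicators of the fibers of [f], which
    are pairwise disjoint. *)
Lemma incidence_gram (R : nzRingType) :
  (incidence R)^T *m incidence R
  = diag_mx (\row_j (fiber_card (enum_val j))%:R).
Proof.
apply/matrixP=> j k; rewrite !mxE.
transitivity (\sum_s ((f s == enum_val j) && (f s == enum_val k))%:R : R).
  rewrite [RHS](reindex_onto enum_val enum_rank) /=; last first.
    by move=> s _; rewrite enum_rankK.
  rewrite [RHS](eq_bigl xpredT); last by move=> i; rewrite enum_valK eqxx.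
  by apply: eq_bigr => i _; rewrite !mxE -natrM mulnb.
case: eqVneq => [->|neq_jk].
  rewrite mulr1n /fiber_card -sum1dep_card natr_sum [RHS]big_mkcond /=.
  by apply: eq_bigr => s _; rewrite andbb; case: eqP.
rewrite big1 // => s _; case: eqP => //= ->.
by rewrite (inj_eq enum_val_inj) (negPf neq_jk).
Qed.

Lemma incidence_cogram (R : nzRingType) i j :
  (incidence R *m (incidence R)^T) i j
  = (f (enum_val i) == f (enum_val j))%:R.
Proof.
rewrite !mxE (bigD1 (enum_rank (f (enum_val i)))) //= !mxE enum_rankK eqxx.
rewrite mul1r.
rewrite big1 ?addr0 1?eq_sym // => k neq_k; rewrite !mxE.
rewrite -(can_eq enum_valK) enum_rankK eq_sym in neq_k.
by rewrite (negPf neq_k) mul0r.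
Qed.

(** Covers [A] (with [a = 0], [c = 1], [h = 0]) and [D - A], [D + A] (with
    [a = 1], [c = -1] or [1], [h = d]) at once; only [c ^+ 2] matters, which is
    why the last two have the same spectrum. *)
Lemma char_poly_star_mx (M : 'M[C]_#|X|) (a c : C) (h : T -> C) :
  (forall s s', M (enum_rank (inl s : X)) (enum_rank (inl s' : X))
     = a *+ (s == s')) ->
  (forall t t', M (enum_rank (inr t : X)) (enum_rank (inr t' : X))
     = h t *+ (t == t')) ->
  (forall s t, M (enum_rank (inl s : X)) (enum_rank (inr t : X))
     = c *+ (f s == t)) ->
  (forall s t, M (enum_rank (inr t : X)) (enum_rank (inl s : X))
     = c *+ (f s == t)) ->
  char_poly M = ('X - a%:P) ^+ (m - n) *
    \prod_t (('X - a%:P) * ('X - (h t)%:P) - (c ^+ 2 * (fiber_card t)%:R)%:P).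
Proof.
move=> Mll Mhh Mlh Mhl; rewrite -(char_poly_mxsub_bij M vertex_index_bij).
pose B := incidence {poly C}.
pose E : 'M_#|T| := diag_mx (\row_j ('X - (h (enum_val j))%:P)).
have blockM : char_poly (mxsub vertex_index vertex_index M)
   = \det (block_mx ('X - a%:P)%:M (- c%:P *: B) (- c%:P *: B^T) E).
  congr (\det _); apply/matrixP=> i j.
  rewrite char_poly_mxE [mxsub _ _ _ _ _]mxE.
  case: (split_ordP i) (split_ordP j) => i1 -> [] j1 ->; rewrite !vertex_indexE.
  - rewrite block_mxEul Mll eq_lshift (inj_eq enum_val_inj) !mxE.
    by rewrite polyCMn -mulrnBl.
  - by rewrite block_mxEur Mlh eq_lrshift !mxE polyCMn sub0r mulNr mulr_natr.
  - by rewrite block_mxEdl Mhl eq_rlshift !mxE polyCMn sub0r mulNr mulr_natr.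
  - rewrite block_mxEdr Mhh eq_rshift (inj_eq enum_val_inj) !mxE.
    by rewrite polyCMn -mulrnBl.
have Xa_neq0 : ('X - a%:P) ^+ n != 0 by rewrite expf_neq0 ?polyXsubC_eq0.
apply: (mulfI Xa_neq0); rewrite blockM det_scalar_block mulrA -exprD.
rewrite subnKC ?leq_hubs_leaves //; congr (_ * _).
rewrite -scalemxAl -scalemxAr scalerA mulrNN -expr2 incidence_gram.
pose hub_factor t :=
  ('X - a%:P) * ('X - (h t)%:P) - (c ^+ 2 * (fiber_card t)%:R)%:P.
have -> : ('X - a%:P) *: E
    - c%:P ^+ 2 *: diag_mx (\row_j (fiber_card (enum_val j))%:R)
   = diag_mx (\row_j hub_factor (enum_val j)).
  apply/matrixP=> i j; rewrite !mxE.
  case: (i == j); rewrite ?mulr0n ?mulr0 ?subr0 // !mulr1n /hub_factor.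
  by rewrite polyCM polyC_exp polyC_natr.
rewrite det_diag [RHS](reindex_onto enum_val enum_rank) /=; last first.
  by move=> t _; rewrite enum_rankK.
by apply: eq_big => [i|i _]; rewrite ?enum_valK ?eqxx // mxE.
Qed.

(** Two distinct leaves have a common neighbor exactly when they hang from the
    same centre, and no other two vertices have any. *)
Lemma char_poly_star_cn_mx :
  char_poly (cn_mx C X) = ('X - (-1)%:P) ^+ (m - n) *
    \prod_t (('X - 0%:P) * ('X - ((fiber_card t)%:R - 1)%:P)).
Proof.
rewrite -(char_poly_mxsub_bij _ vertex_index_bij).
pose B := incidence {poly C}.
have -> : char_poly (mxsub vertex_index vertex_index (cn_mx C X))
   = \det (block_mx (('X + 1)%:M - B *m B^T) 0 0 ('X%:M : 'M_#|T|)).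
  congr (\det _); apply/matrixP=> i j.
  rewrite char_poly_mxE [mxsub _ _ _ _ _]mxE.
  case: (split_ordP i) (split_ordP j) => i1 -> [] j1 ->; rewrite !vertex_indexE.
  - rewrite block_mxEul [RHS]mxE [X in _ = _ + X]mxE incidence_cogram !mxE.
    rewrite eq_lshift (inj_eq enum_rank_inj) (inj_eq inl_inj) !enum_rankK.
    rewrite (inj_eq enum_val_inj); case: eqVneq => [->|neq].
      by rewrite eqxx subr0 !mulr1n addrK.
    by rewrite common_nbrs_leaves ?(inj_eq enum_val_inj) // polyC_natr.
  - rewrite block_mxEur eq_lrshift !mxE (inj_eq enum_rank_inj) !enum_rankK.
    by rewrite common_nbrs_mixed subrr.
  - rewrite block_mxEdl eq_rlshift !mxE (inj_eq enum_rank_inj) !enum_rankK.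
    by rewrite common_nbrsC common_nbrs_mixed subrr.
  - rewrite block_mxEdr eq_rshift !mxE (inj_eq enum_rank_inj) (inj_eq inr_inj).
    rewrite !enum_rankK (inj_eq enum_val_inj); case: eqVneq => [_|neq].
      by rewrite subr0.
    by rewrite common_nbrs_hubs ?(inj_eq enum_val_inj) // subr0.
rewrite det_ublock det_scalar.
have X1_neq0 : ('X + 1 : {poly C}) ^+ n != 0.
  by rewrite expf_neq0 // -[1]opprK -polyCN polyXsubC_eq0.
apply: (mulfI X1_neq0); rewrite mulrA det_sylvester incidence_gram.
rewrite polyCN opprK mulrA -exprD subnKC ?leq_hubs_leaves // -mulrA.
congr (_ * _); rewrite subr0 big_split /= prodr_const mulrC; congr (_ * _).
have -> : ('X + 1)%:M - diag_mx (\row_j (fiber_card (enum_val j))%:R)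
   = diag_mx (\row_(j < #|T|) ('X - ((fiber_card (enum_val j))%:R - 1)%:P))
   :> 'M[{poly C}]_#|T|.
  apply/matrixP=> i j; rewrite !mxE -mulrnBl polyCB polyC_natr polyC1.
  by rewrite opprB addrA.
rewrite det_diag [RHS](reindex_onto enum_val enum_rank) /=; last first.
  by move=> t _; rewrite enum_rankK.
by apply: eq_big => [i|i _]; rewrite ?enum_valK ?eqxx // mxE.
Qed.

Lemma star_energy : energy C X = \sum_t 2 * sqrtC (fiber_card t)%:R.
Proof.
rewrite /energy (@sum_eigenvalues _ _ _ _ 0 (m - n) T
  (fun t => sqrtC (fiber_card t)%:R) (fun t => - sqrtC (fiber_card t)%:R)).
  rewrite normr0 mul0rn add0r; apply: eq_bigr => t _.
  by rewrite normrN ger0_norm ?sqrtC_ge0 ?ler0n // mulr_natl.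
rewrite (@char_poly_star_mx _ 0 1 (fun=> 0)).
- congr (_ * _); apply: eq_bigr => t _; rewrite !subr0 expr1n mul1r.
  by rewrite polyCN opprK -subr_sqr -polyC_exp sqrtCK.
- by move=> s s'; rewrite mxE !enum_rankK /= e_leaf mul0rn.
- by move=> t t'; rewrite mxE !enum_rankK /= e_hub mul0rn.
- by move=> s t; rewrite mxE !enum_rankK /= e_cross.
- by move=> s t; rewrite mxE !enum_rankK /= e_sym e_cross.
Qed.

Lemma avg_degreeE : avg_degree C X = (m.*2)%:R / (m + n)%:R.
Proof. by rewrite /avg_degree card_edges card_vertices -natrM mul2n. Qed.

Lemma avg_degree_bounds :
  (0 < m + n)%N -> 1 <= avg_degree C X /\ avg_degree C X <= 2.
Proof.
move=> X_gt0; rewrite avg_degreeE; split.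
  rewrite ler_pdivlMr ?ltr0n // mul1r ler_nat -addnn leq_add2l.
  exact: leq_hubs_leaves.
by rewrite ler_pdivrMr ?ltr0n // -natrM ler_nat mul2n leq_double leq_addr.
Qed.

(** The eigenvalue [d t + 1] is at least [2], hence at least the average degree,
    so [0] and [d t + 1] together contribute [d t + 1] and the average cancels; the
    repeated eigenvalue [1] is at most the average. *)
Lemma sum_star_laplacian (k : nat) (M : 'M[C]_#|X|) :
  M = deg_mx C X + (-1) ^+ k *: adj_mx C X ->
  \sum_(x <- eigenvalues M) `|x - avg_degree C X|
  = (m - n)%:R * (avg_degree C X - 1) + (m + n)%:R.
Proof.
move=> defM; set d := avg_degree C X.
rewrite (@sum_eigenvalues _ _ _ _ 1 (m - n) T
  (fun=> 0) (fun t => (fiber_card t)%:R + 1)).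
  congr (_ + _).
    have [->|mn_gt0] := posnP (m - n); first by rewrite mul0r.
    have [|d_ge1 _] := avg_degree_bounds.
      by rewrite ltn_addr // (leq_trans mn_gt0) ?leq_subr.
    by rewrite distrC ger0_norm ?subr_ge0 // mulr_natl.
  rewrite -sum_fiber_card /n -sum1_card -big_split natr_sum /=.
  apply: eq_bigr => t _; have [|d_ge1 d_le2] := avg_degree_bounds.
    by rewrite ltn_addl // /n (cardD1 t).
  rewrite sub0r normrN ger0_norm ?(le_trans ler01) // ger0_norm.
    by rewrite addrC subrK natrD.
  rewrite subr_ge0 (le_trans d_le2) // -[2]/(1 + 1) lerD2r ler1n.
  exact: fiber_card_gt0.
rewrite (@char_poly_star_mx _ 1 ((-1) ^+ k) (fun t => (fiber_card t)%:R)).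
- congr (_ * _); apply: eq_bigr => t _; rewrite -exprM mulnC exprM sqrrN.
  by rewrite !expr1n mul1r !polyCD subr0 !polyC1; ring.
- move=> s s'; rewrite defM !mxE !enum_rankK /= e_leaf mulr0 addr0 degree_leaf.
  by rewrite (inj_eq enum_rank_inj).
- move=> t t'; rewrite defM !mxE !enum_rankK /= e_hub mulr0 addr0 degree_hub.
  by rewrite (inj_eq enum_rank_inj).
- move=> s t; rewrite defM !mxE !enum_rankK /= e_cross.
  by rewrite (inj_eq enum_rank_inj) mulr0n add0r mulr_natr.
- move=> s t; rewrite defM !mxE !enum_rankK /= e_sym e_cross.
  by rewrite (inj_eq enum_rank_inj) mulr0n add0r mulr_natr.
Qed.

Lemma star_laplacian_energy :
  laplacian_energy C X = (m - n)%:R * (avg_degree C X - 1) + (m + n)%:R.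
Proof. by apply: (sum_star_laplacian (k := 1)); rewrite expr1 scaleN1r. Qed.

Lemma star_signless_laplacian_energy :
  signless_laplacian_energy C X
  = (m - n)%:R * (avg_degree C X - 1) + (m + n)%:R.
Proof. by apply: (sum_star_laplacian (k := 0)); rewrite expr0 scale1r. Qed.

Lemma star_cn_energy : cn_energy C X = (2 * (m - n))%:R.
Proof.
rewrite /cn_energy (sum_eigenvalues _ char_poly_star_cn_mx) normrN1.
rewrite mul2n -addnn [RHS]natrD; congr (_ + _).
rewrite natrB ?leq_hubs_leaves // -sum_fiber_card /n -sum1_card !natr_sum.
rewrite -sumrB.
apply: eq_bigr => t _.
by rewrite normr0 add0r ger0_norm // subr_ge0 ler1n fiber_card_gt0.
Qed.

End StarForest.

(** * Subgroups and generating pairs of the dihedral group *)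

Section Groups.
Local Open Scope nat_scope.
Local Open Scope group_scope.

(** Once [b ^+ 2 = 1], the relation [b * a * b = a^-1] says that [b] conjugates
    [a] to its inverse, as in the presentation of ['D_(2q)]. *)
Lemma homg_dihedral_presentation (gT : finGroupType) (G : {group gT}) q :
  (G \homg Grp (a : b : (a ^+ q, b ^+ 2, b * a * b = a^-1)))
  = (G \homg Grp (x : y : x ^+ q, y ^+ 2, x ^ y = x^-1)).
Proof.
apply: eq_existsb => -[a b] /=; rewrite !xpair_eqE.
congr (_ && (_ && _)); apply: andb_id2l => /eqP b2.
have bV : b^-1 = b by apply/eqP; rewrite eq_invg_mul -expg2 b2.
by rewrite conjgE bV -mulgA.
Qed.

(** The presentation enters only through these three facts.  An element outside
    [<[a]>] is some [a ^+ i * b], and [b] inverts [a ^+ i]. *)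
Lemma dihedral_rotations (gT : finGroupType) p :
  prime p -> is_dihedral gT p ->
  exists R : {group gT},
    [/\ #|R| = p, #|gT| = p.*2 & forall x, x \notin R -> x ^+ 2 = 1].
Proof.
move=> p_prime gT_dih; have p_gt1 := prime_gt1 p_prime.
have /card_isog oG : [set: gT] \isog [set: 'D_(p.*2)].
  rewrite isogEhom (Grp_dihedral p_gt1) gT_dih homg_dihedral_presentation.
  by rewrite -homg_dihedral_presentation (isoGrp_hom gT_dih)
     -Grp_dihedral ?homg_refl.
rewrite cardsT card_dihedral // in oG.
have /existsP[[a b] /= /eqP[defG ap b2 bab]] := isoGrp_hom gT_dih.
have bV : b^-1 = b by apply/eqP; rewrite eq_invg_mul -expg2 b2.
have ab : a ^ b = a^-1 by rewrite conjgE bV -bab mulgA.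
rewrite norm_joinEr in defG; last by rewrite norms_cycle ab groupV cycle_id.
have le_b : #[b] <= 2 by rewrite dvdn_leq // order_dvdn b2.
have le_a : #[a] <= p by rewrite dvdn_leq ?prime_gt0 // order_dvdn ap.
have := mul_cardG <[a]> <[b]>.
rewrite defG cardsT oG -muln2 -!orderE => oab.
(* The group has order 2p, which bounds #[a] * #[b] from below. *)
have oa : #[a] = p.
  apply/eqP; rewrite eqn_leq le_a -(leq_pmul2r (isT : 0 < 2)).
  rewrite (leq_trans (leq_pmulr _ (cardG_gt0 (<[a]> :&: <[b]>)))) // -oab.
  by rewrite leq_mul.
exists <[a]>%G; split=> // x xR.
have: x \in <[a]> * <[b]> by rewrite defG inE.
case/mulsgP=> _ _ /cycleP[i ->] /cycleP[j ->] def_x.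
have{def_x} def_x : x = a ^+ i * b ^+ odd j.
  rewrite def_x -{1}(odd_double_half j) expgD -muln2 mulnC expgM b2.
  by rewrite expg1n mulg1.
case: (odd j) def_x xR => [-> _|->]; last by rewrite mulg1 mem_cycle.
rewrite expg1 expg2 mulgA -(mulgA (a ^+ i)) -(mulgA (a ^+ i)).
have -> : b * a ^+ i * b = (a ^+ i)^-1.
  by rewrite -expgVn -ab -conjXg conjgE bV mulgA.
by rewrite mulgV.
Qed.

Definition gen_pair (gT : finGroupType) (u : gT * gT) : {group gT} :=
  <<[set u.1; u.2]>>%G.

Lemma fiber_gen_pair1 (gT : finGroupType) :
  fiber_card (@gen_pair gT) 1%G = 1%N.
Proof.
rewrite -(cards1 (1 : gT, 1 : gT)); congr #|pred_of_set _|.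
apply/setP=> -[a b]; rewrite !inE xpair_eqE -val_eqE /=.
by rewrite -subG1 gen_subG subUset !sub1set !inE.
Qed.

(** In a group of prime order every pair generates the group, except the pair of
    identities. *)
Lemma fiber_gen_pair_prime (gT : finGroupType) (H : {group gT}) :
  prime #|H| -> fiber_card (@gen_pair gT) H = (#|H| ^ 2).-1.
Proof.
move=> prH; rewrite /fiber_card.
have -> : [set u | gen_pair u == H] = setX H H :\ (1, 1).
  apply/setP=> -[a b]; rewrite !inE /= xpair_eqE; apply/eqP/andP.
    move=> defH; have sH : [set a; b] \subset H by rewrite -defH subset_gen.
    rewrite subUset !sub1set in sH; split=> //.
    apply: contraTN prH => /andP[/eqP a1 /eqP b1].
    have -> : H :=: 1.
      by rewrite -defH /= a1 b1; apply/trivgP; rewrite gen_subG subUset subxx.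
    by rewrite cards1.
  case=> n1 HH; apply/val_inj => /=.
  have sH : <<[set a; b]>> \subset H by rewrite gen_subG subUset !sub1set.
  have [|tiH] := prime_subgroupVti <<[set a; b]>>%G prH.
    by move=> sHg; apply/eqP; rewrite eqEsubset sH.
  case/negP: n1; move/setIidPl: sH => /=; rewrite tiH => /esym/trivgP.
  by rewrite gen_subG subUset !sub1set !inE.
have := cardsD1 (1, 1) (setX H H).
by rewrite cardsX mulnn inE /= !group1 => ->.
Qed.

Section DihedralPrime.
Variables (gT : finGroupType) (R : {group gT}) (p : nat).
Hypotheses (p_prime : prime p) (oR : #|R| = p) (oG : #|gT| = p.*2).
Hypothesis reflection_sqr : forall x, x \notin R -> x ^+ 2 = 1.

Lemma order_reflection x : x \notin R -> #[x] = 2.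
Proof.
move=> xR; apply: nt_prime_order (reflection_sqr xR) _ => //.
by apply: contraNneq xR => ->.
Qed.

Lemma card_reflections : #|~: R| = p.
Proof. by rewrite cardsCs setCK oG oR -addnn addnK. Qed.

(** A subgroup [H] inside [R] is [1] or [R] because [p] is prime.  Otherwise
    either it contains [R] properly and is the whole group, since [R] has index
    [2], or it meets [R] trivially, and then [#|H| * p <= 2 * p] leaves no room
    beyond one reflection. *)
Lemma dihedral_subgroups (H : {group gT}) :
  [\/ H = 1%G, H = R, H = [set: gT]%G | exists2 x, x \notin R & H = <[x]>%G].
Proof.
have [sHR|/subsetPn[x xH xR]] := boolP (H \subset R).
  have [sRH|tiRH] := prime_subgroupVti H (etrans (congr1 prime oR) p_prime).
    by constructor 2; apply/val_inj/eqP; rewrite /= eqEsubset sHR.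
  constructor 1; apply/val_inj; rewrite /= -tiRH; exact/esym/setIidPl.
have [sRH|tiRH] := prime_subgroupVti H (etrans (congr1 prime oR) p_prime).
  constructor 3; apply/val_inj/eqP; rewrite /= eqEcard subsetT cardsT oG -oR.
  have pxH : R \proper H.
    by rewrite properE sRH; apply/subsetPn; exists x.
  have /dvdnP[k oH] := cardSg sRH.
  have := proper_card pxH.
  rewrite oH -[X in X < _]mul1n ltn_pmul2r ?cardG_gt0 //.
  by move=> k2; rewrite -mul2n leq_mul2r k2 orbT.
constructor 4; exists x => //; apply/val_inj/eqP.
rewrite /= eq_sym eqEcard cycle_subG xH -orderE order_reflection //=.
rewrite -(leq_pmul2r (prime_gt0 p_prime)) -{1}oR -TI_cardMg //.
by rewrite mul2n -oG max_card.
Qed.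

(** The subgroups of [dihedral_subgroups] have to be pairwise distinct; the ones
    of order [2] are, since [x] is the only nontrivial element of [<[x]>]. *)
Lemma sum_dihedral_subgroups (V : nmodType) (F : {group gT} -> V) :
  (\sum_H F H = F 1%G + F R + F [set: gT]%G + \sum_(x in ~: R) F <[x]>%G)%R.
Proof.
have R_neq1 : R != 1%G.
  by rewrite -val_eqE /= -cardG_gt1 oR prime_gt1.
have G_neq1 : [set: gT]%G != 1%G.
  apply: contraNneq R_neq1 => G1; apply/eqP/val_inj/trivgP.
  by have := subsetT R; rewrite -[setTfor _]/(gval [set: gT]%G) G1.
have G_neqR : [set: gT]%G != R.
  apply/eqP=> /(congr1 (fun H : {group gT} => #|H|)) /eqP.
  rewrite cardsT oG oR -addnn -[X in _ == X]addn0 eqn_add2l.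
  by rewrite gtn_eqF ?prime_gt0.
rewrite (bigD1 1%G) //= (bigD1 R) //= (bigD1 [set: gT]%G) ?G_neq1 //=.
rewrite !GRing.addrA; congr (_ + _)%R.
have cyc_inj : {in ~: R &, injective (fun x => <[x]>%G)}.
  move=> x y; rewrite !inE => xR yR /(congr1 val) /= xy.
  have : x \in <[y]> by rewrite -xy cycle_id.
  rewrite cycle2g ?order_reflection // !inE => /orP[|/eqP //].
  by move/eqP=> x1; rewrite x1 group1 in xR.
rewrite -(big_imset _ cyc_inj) /=; apply: eq_bigl => H.
apply/idP/imsetP => [|[x]].
  case/andP=> /andP[/eqP H1 /eqP HR] /eqP HG.
  by case: (dihedral_subgroups H) => // -[x xR ->]; exists x; rewrite ?inE.
rewrite inE => xR ->; rewrite -!andbA; apply/and3P; split.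
- by rewrite -val_eqE /= cycle_eq1; apply: contraNneq xR => ->.
- by apply: contraNneq xR => <-; rewrite cycle_id.
apply/eqP=> /(congr1 (fun H : {group gT} => #|H|)).
rewrite cardsT oG -orderE order_reflection // -mul2n.
by move/eqP; rewrite -[X in X == _]muln1 eqn_pmul2l // ltn_eqF // prime_gt1.
Qed.

Lemma fiber_rotations : fiber_card (@gen_pair gT) R = (p ^ 2).-1.
Proof. by rewrite fiber_gen_pair_prime oR. Qed.

Lemma fiber_reflection x :
  x \notin R -> fiber_card (@gen_pair gT) <[x]>%G = 3.
Proof.
by move=> xR; rewrite fiber_gen_pair_prime /= -orderE order_reflection.
Qed.

Lemma card_pairs : #|{: gT * gT}| = (4 * p ^ 2)%N.
Proof. by rewrite card_prod oG -muln2 mulnACA mulnn mulnC. Qed.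

(** What is left of the [4 * p ^ 2] pairs when those generating a proper
    subgroup are removed. *)
Lemma fiber_full : fiber_card (@gen_pair gT) [set: gT]%G = (3 * p * p.-1)%N.
Proof.
have := sum_fiber_card (@gen_pair gT).
rewrite card_pairs sum_dihedral_subgroups fiber_gen_pair1 fiber_rotations.
rewrite (eq_bigr (fun=> 3)); last by move=> x; rewrite inE => /fiber_reflection.
rewrite sum_nat_const card_reflections.
rewrite -![(_ + _)%R]/(_ + _)%N; case: p p_prime => // q _ /=; nia.
Qed.

Lemma gen_pair_surj (H : {group gT}) : exists u, gen_pair u = H.
Proof.
suff : 0 < fiber_card (@gen_pair gT) H.
  by case/card_gt0P=> u; rewrite inE => /eqP <-; exists u.
have p_gt1 := prime_gt1 p_prime.
case: (dihedral_subgroups H) => [->|->|->|[x xR ->]].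
- by rewrite fiber_gen_pair1.
- by rewrite fiber_rotations; nia.
- by rewrite fiber_full; nia.
by rewrite fiber_reflection.
Qed.

Lemma card_dihedral_subgroups : #|{: {group gT}}| = (p + 3)%N.
Proof.
rewrite -sum1_card (sum_dihedral_subgroups (fun=> 1%N)) sum1_card.
by rewrite card_reflections [_ + _]addrC.
Qed.

End DihedralPrime.

End Groups.

(** * The subgroup generating graph of the dihedral group *)

Theorem theorem3p3 (C : numClosedFieldType) (p : nat) (p_prime : prime p)
    (gT : finGroupType) (gT_dihedral : is_dihedral gT p) :
  [/\ energy C (gen_graph gT) =
        2 + 2 * p%:R * sqrtC 3 + 2 * sqrtC (p%:R ^+ 2 - 1)
          + 2 * sqrtC (3 * p%:R * (p%:R - 1)),
      laplacian_energy C (gen_graph gT) =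
        signless_laplacian_energy C (gen_graph gT),
      signless_laplacian_energy C (gen_graph gT) =
        (32 * p%:R ^+ 4 + 2 * p%:R ^+ 2 + 12 * p%:R + 18)
          / (4 * p%:R ^+ 2 + p%:R + 3)
    & cn_energy C (gen_graph gT) = 8 * p%:R ^+ 2 - 2 * p%:R - 6].
Proof.
have [R [oR oG reflR]] := dihedral_rotations p_prime gT_dihedral.
have p_gt0 := prime_gt0 p_prime.
pose f := @gen_pair gT.
have e_cross u H : @gen_adj gT (inl u) (inr H) = (f u == H).
  by rewrite eq_sym -val_eqE.
have e_leaf u v : @gen_adj gT (inl u) (inl v) = false by [].
have e_hub H K : @gen_adj gT (inr H) (inr K) = false by [].
have f_surj := gen_pair_surj p_prime oR oG reflR.
have m_pairs := card_pairs oG.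
have n_groups := card_dihedral_subgroups p_prime oR oG reflR.
have le_nm := leq_hubs_leaves f_surj; rewrite m_pairs n_groups in le_nm.
have mE : (4 * p ^ 2)%:R = 4 * p%:R ^+ 2 :> C by rewrite natrM natrX.
have nE : (p + 3)%:R = p%:R + 3 :> C by rewrite natrD.
have signlessE : signless_laplacian_energy C (gen_graph gT) =
    (32 * p%:R ^+ 4 + 2 * p%:R ^+ 2 + 12 * p%:R + 18)
      / (4 * p%:R ^+ 2 + p%:R + 3).
  rewrite (star_signless_laplacian_energy _ _ e_leaf e_hub e_cross f_surj).
  rewrite (avg_degreeE _ _ e_leaf e_hub e_cross) m_pairs n_groups natrB //.
  rewrite -mul2n (natrD _ (4 * p ^ 2)%N) (natrM _ 2) mE nE addrA; field.
  by rewrite -(addrA (4 * _)) -nE -mE -natrD pnatr_eq0 addn3 addnS.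
split; [|  | exact: signlessE |].
- rewrite (star_energy _ _ e_leaf e_hub e_cross f_surj).
  rewrite (sum_dihedral_subgroups p_prime oR oG reflR).
  rewrite fiber_gen_pair1 (fiber_rotations p_prime oR).
  rewrite (fiber_full p_prime oR oG reflR).
  rewrite (eq_bigr (fun=> 2 * sqrtC 3)); last first.
    by move=> x; rewrite inE => xR; rewrite (fiber_reflection reflR).
  rewrite sumr_const (card_reflections oR oG) sqrtC1 !natrM.
  rewrite -!subn1 !natrB ?expn_gt0 ?p_gt0 // natrX -mulr_natr.
  ring.
- by rewrite (star_laplacian_energy _ _ e_leaf e_hub e_cross f_surj)
     (star_signless_laplacian_energy _ _ e_leaf e_hub e_cross f_surj).
- rewrite (star_cn_energy _ _ e_leaf e_hub e_cross f_surj) m_pairs n_groups.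
  rewrite natrM natrB // mE nE; ring.
Qed.
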